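(* Let $p$ be an odd prime and $k\in\mathbb{N}$ with $2\le k\le\frac{p-1}{2}$ such that $p>2k+1$ and $p\equiv 1\pmod{2k}$. Suppose $n\in\{\frac{p-1}{k}+1,\frac{p-1}{k}+2,\ldots,\frac{2(p-1)}{k}-1\}$ is odd and $d\in\mathbb{Z}$ satisfies $\chi_k(d)=1$. (a) If $k$ is even, then $\left(\frac{S_{n,k}(d,p)}{p}\right)\neq -1$. (b) If $k$ is odd, then $$\left(\frac{S_{n,k}(d,p)}{p}\right)\neq\begin{cases}-1, & \text{if } p\equiv 1\pmod{4k};\\ \left(\frac{d}{p}\right), & \text{if } p\equiv 2k+1\pmod{4k}.\end{cases}$$
   Context: For an odd prime $p$ and an integer $k\ge 2$ with $k\mid p-1$, let $\alpha_1,\ldots,\alpha_{(p-1)/k}$ be integers representing the distinct (nonzero) $k$-th power residues modulo $p$. For $n\in\mathbb{N}$ and $d\in\mathbb{Z}$, $$S_{n,k}(d,p)=\det\left[(\alpha_i+d\,\alpha_j)^n\right]_{1\le i,j\le \frac{p-1}{k}}.$$ $\chi_k$ denotes a multiplicative character of order $k$ modulo $p$; the condition $\chi_k(d)=1$ is equivalent to $d^{(p-1)/k}\equiv 1\pmod p$. $\left(\frac{\cdot}{p}\right)$ is the Legendre symbol. *)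

(* Defs.v *)
From HB Require Import structures.
From mathcomp Require Import all_boot all_order all_algebra.
From mathcomp Require Import all_fingroup all_solvable all_field all_character.

Set Implicit Arguments.
Unset Strict Implicit.
Unset Printing Implicit Defensive.

Import Order.TTheory GRing.Theory Num.Theory.

Local Open Scope ring_scope.

(* Throughout, p is meant to be prime: 'F_p is then Z/p, and a%:~R : 'F_p is
   the class of a : int modulo p. *)

Definition legendre (a : int) (p : nat) : int :=
  if (a%:~R : 'F_p) == 0 then 0
  else if [exists x : 'F_p, x ^+ 2 == a%:~R] then 1 else -1.

(* A multiplicative character modulo p is a linear character of the unit group
   of 'F_p; as usual it is extended by 0 to the integers divisible by p. *)
Definition mulchar_val (p : nat) (chi : 'CF([set: {unit 'F_p}])) (d : int)
    : algC :=
  if insub (d%:~R : 'F_p) is Some u then chi (u : {unit 'F_p}) else 0.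

Definition mulchar_of_order (p k : nat) (chi : 'CF([set: {unit 'F_p}])) : Prop :=
  chi \is a linear_char /\ #[chi]%CF = k.

Definition kth_power_residues (p k m : nat) (alpha : 'I_m -> int) : Prop :=
  injective (fun i => (alpha i)%:~R : 'F_p) /\
  forall x : 'F_p,
    (exists i, (alpha i)%:~R = x) <-> (x != 0 /\ exists y : 'F_p, y ^+ k = x).

Definition S_det (m n : nat) (alpha : 'I_m -> int) (d : int) : int :=
  \det (\matrix_(i < m, j < m) (alpha i + d * alpha j) ^+ n).

(* Main.v *)
(* The k-th power residues form the group H of m-th roots of unity in F_p, where
   m = (p - 1) / k is even, and d mod p lies in H. On H the function x |-> (x + d)^n
   agrees with sum_(r < m) e_r x^r, e_r = d^(n - r) (C(n, r) + C(n, m + r)), so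
   factoring a_j^n out of column j leaves a group matrix with eigenvalues m e_r and
     S = m^m (prod_r e_r) (prod_(a in H) a)^n = - d^(m/2) q^2  (mod p):
   the product over H is -1 with n odd, the powers of d collapse to d^(m/2) = +-1,
   and the binomial factors pair up by the symmetry C(n, l) = C(n, n - l), without
   fixed points since n is odd. It remains to see whether -1 is a square. *)
Require Import Defs.
From mathcomp Require Import all_boot all_order all_algebra.
From mathcomp Require Import all_fingroup all_solvable all_field all_character.
From mathcomp Require Import zify ring.

Set Implicit Arguments.
Unset Strict Implicit.
Unset Printing Implicit Defensive.

Import GRing.Theory.
Local Open Scope ring_scope.

Lemma prod_palindrome (h : nat) (f : nat -> nat) :
    (forall i, (i < h)%N -> f (h.*2.-1 - i)%N = f i) ->
  (\prod_(0 <= i < h.*2) f i = (\prod_(0 <= i < h) f i) ^ 2)%N.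
Proof.
move=> fP; rewrite (big_cat_nat (n := h)) //=; try lia.
rewrite -mulnn; congr (_ * _)%N.
rewrite big_nat_rev -{1}[h]add0n big_addn -addnn addnK.
by apply: eq_big_nat => i /andP[_ ih]; rewrite -(fP i ih); congr f; lia.
Qed.

(** The exponent of [d] in the product of the [e_r]. It is left as [h] times an odd number so that
    [d ^+ h.*2 = 1] reduces it to [h]. *)
Lemma sum_subn_range (h n : nat) : (h.*2 <= n)%N ->
  (\sum_(0 <= r < h.*2) (n - r) = h * (n - h).*2.+1)%N.
Proof.
elim: h => [|h IH] hn; first by rewrite big_geq.
by rewrite doubleS !big_nat_recr //= IH; nia.
Qed.

(* With t = n - m, the factors of index r <= t are symmetric under r |-> t - r, and
   those of index r > t, where 'C(n, m + r) = 0, under r |-> n - r. *)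
Lemma prod_folded_binomials_square (m n : nat) :
    ~~ odd m -> odd n -> (m <= n < m.*2)%N ->
  exists c, (\prod_(0 <= r < m) ('C(n, r) + 'C(n, m + r)) = c ^ 2)%N.
Proof.
move=> m_even n_odd n_range; have [t n_def] : exists t, n = (m + t)%N by exists (n - m)%N; lia.
have t_odd : odd t by lia.
rewrite (big_cat_nat (n := t.+1)) //=; try lia.
have -> : t.+1 = (t.+1./2).*2 by lia.
rewrite prod_palindrome; last first.
  move=> i ih; have -> : ((t.+1./2).*2.-1 - i = t - i)%N by lia.
  (* As [n = m + t], the map [r |-> t - r] swaps the two binomials of a factor. *)
  rewrite addnC -(@bin_sub n i); last by lia.
  rewrite -(@bin_sub n (m + i)); last by lia.
  by congr ('C(_, _) + 'C(_, _))%N; lia.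
rewrite -{1}[(t.+1./2).*2]add0n big_addn.
have -> : (m - (t.+1./2).*2)%N = ((m - t.+1)./2).*2 by lia.
rewrite prod_palindrome; last first.
  move=> i ih; rewrite [X in (_ + X)%N = _]bin_small; last by lia.
  rewrite [X in _ = (_ + X)%N]bin_small; last by lia.
  rewrite !addn0 -[RHS]bin_sub; last by lia.
  by congr 'C(_, _); lia.
by rewrite -expnMn; eexists.
Qed.

Lemma exprDn_unity (F : fieldType) (m n : nat) (x d : F) :
    (m <= n < m.*2)%N -> x ^+ m = 1 -> d ^+ m = 1 ->
  (x + d) ^+ n =
  \sum_(r < m) d ^+ (n - r) * ('C(n, r) + 'C(n, m + r))%:R * x ^+ r.
Proof.
move=> n_range xm dm; rewrite addrC exprDn.
rewrite -(big_mkord xpredT (fun i => d ^+ (n - i) * x ^+ i *+ 'C(n, i))).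
have -> : \sum_(0 <= i < n.+1) d ^+ (n - i) * x ^+ i *+ 'C(n, i) =
          \sum_(0 <= i < m + m) d ^+ (n - i) * x ^+ i *+ 'C(n, i).
  rewrite [RHS](big_cat_nat (n := n.+1)) //=; last by lia.
  rewrite [X in _ + X]big_nat [X in _ + X]big1 ?addr0 // => i /andP[ni _].
  by rewrite bin_small.
rewrite big_mkord big_split_ord /= -big_split /=; apply: eq_bigr => r _.
rewrite natrD mulrDr mulrDl exprD xm mul1r.
congr (_ + _); first by rewrite -mulr_natr mulrAC.
(* Past [n] the truncated exponent [n - (m + r)] is wrong, but its binomial vanishes. *)
have [mr|nm] := leqP (m + r) n; last by rewrite bin_small // mulr0n mulr0 mul0r.
have -> : (n - r = m + (n - (m + r)))%N by lia.
by rewrite exprD dm mul1r -mulr_natr mulrAC.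
Qed.

Lemma unity_root_neq0 (F : fieldType) (m : nat) (x : F) :
  (0 < m)%N -> x ^+ m = 1 -> x != 0.
Proof.
move=> m_gt0; apply: contra_eqN => /eqP ->.
by rewrite expr0n gtn_eqF // eq_sym oner_eq0.
Qed.

Section RootsOfUnity.
Variables (F : fieldType) (m : nat) (a : 'I_m -> F).
Hypotheses (m_gt0 : (0 < m)%N) (a_inj : injective a) (am : forall i, a i ^+ m = 1).

(** The [a i] are all the roots of ['X^m - 1]; evaluate its factorization at 0. *)
Lemma prod_unity_roots : ~~ odd m -> \prod_i a i = -1.
Proof.
move=> m_even.
have sz : size ('X^m - 1 : {poly F}) = (size (codom a)).+1.
  by rewrite size_codom card_ord size_XnsubC.
have := all_roots_prod_XsubC sz; rewrite uniq_rootsE.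
have -> : uniq (codom a) by exact/injectiveP.
have -> : all (root ('X^m - 1)) (codom a).
  by apply/allP => _ /codomP[i ->]; rewrite rootE !hornerE am subrr.
move=> /(_ isT isT)/(congr1 (horner^~ 0)).
rewrite (monicP (monicXnsubC 1 m_gt0)) scale1r !hornerE expr0n gtn_eqF // sub0r.
rewrite horner_prod big_image /= => ->.
under [RHS]eq_bigr => i _ do rewrite !hornerE -mulN1r.
by rewrite big_split /= prodr_const card_ord -signr_odd (negPf m_even) mul1r.
Qed.

(** The matrix is [V * diag(e) * W * diag(a_j ^ n)] with [V], [W] Fourier matrices. Only
    [\det (V *m W)] is needed, and [V *m W] is scalar by orthogonality (a geometric sum). *)
Lemma det_unity_convolution (n : nat) (e : 'I_m -> F) :
  \det (\matrix_(i < m, j < m) (a j ^+ n * \sum_r e r * (a i / a j) ^+ r)) =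
  m%:R ^+ m * (\prod_r e r) * (\prod_i a i) ^+ n.
Proof.
have a_neq0 i : a i != 0 by apply: unity_root_neq0 (am i).
pose V := \matrix_(i < m, r < m) a i ^+ r.
pose W := \matrix_(r < m, j < m) a j ^- r.
have VW : V *m W = m%:R%:M.
  apply/matrixP => i j; rewrite !mxE.
  under eq_bigr => r _ do rewrite !mxE -expr_div_n.
  have [->|ij] := eqVneq i j.
    by under eq_bigr => r _ do rewrite divff ?a_neq0 // expr1n; rewrite sumr_const card_ord.
  have /eqP : (a i / a j) ^+ m - 1 = 0 by rewrite expr_div_n !am divr1 subrr.
  rewrite subrX1 mulf_eq0 subr_eq0 => /orP[/eqP aij|/eqP->//].
  by case/eqP: ij; apply: a_inj; rewrite -[a j]mul1r -aij divfK.
transitivity (\det (V *m diag_mx (\row_r e r) *m W *m diag_mx (\row_j a j ^+ n))).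
  congr (\det _); apply/matrixP => i j.
  rewrite mul_mx_diag !mxE mulrC; congr (_ * _); apply: eq_bigr => r _.
  by rewrite mul_mx_diag !mxE expr_div_n mulrA [e r * _]mulrC.
rewrite !det_mulmx !det_diag [\det V * _ * _]mulrAC -det_mulmx VW.
rewrite det_scalar; congr (_ * _ * _); first by apply: eq_bigr => r _; rewrite mxE.
by rewrite -prodrXl; apply: eq_bigr => i _; rewrite mxE.
Qed.

End RootsOfUnity.

Lemma det_power_sums_square (F : fieldType) (m n : nat) (a : 'I_m -> F) (d : F) :
    (0 < m)%N -> ~~ odd m -> odd n -> (m <= n < m.*2)%N -> injective a ->
    (forall i, a i ^+ m = 1) -> d ^+ m = 1 ->
  exists q : F,
    \det (\matrix_(i < m, j < m) (a i + d * a j) ^+ n) = - d ^+ m./2 * q ^+ 2.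
Proof.
move=> m_gt0 m_even n_odd n_range a_inj am dm.
have [c cP] := prod_folded_binomials_square m_even n_odd n_range.
(* Square root of [m ^ m] times the product of the folded binomials. *)
exists (m%:R ^+ m./2 * c%:R).
pose e (r : 'I_m) : F := d ^+ (n - r) * ('C(n, r) + 'C(n, m + r))%:R.
transitivity (m%:R ^+ m * (\prod_r e r) * (\prod_i a i) ^+ n).
  rewrite -det_unity_convolution //; congr (\det _); apply/matrixP => i j.
  have aj : a j != 0 by apply: unity_root_neq0 (am j).
  rewrite !mxE -exprDn_unity //; last by rewrite expr_div_n !am divr1.
  by rewrite -exprMn mulrDr mulrCA divff // mulr1 [d * _]mulrC.
rewrite (prod_unity_roots m_gt0 a_inj am m_even) -signr_odd n_odd expr1.
have -> : \prod_r e r = d ^+ m./2 * c%:R ^+ 2.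
  rewrite big_split /= -(big_mkord xpredT (fun r => d ^+ (n - r))).
  rewrite -(big_mkord xpredT (fun r => ('C(n, r) + 'C(n, m + r))%:R)).
  rewrite -natr_prod cP natrX; congr (_ * _).
  rewrite -(big_morph _ (exprD d) (expr0 d)).
  have mE : m = m./2.*2 by lia.
  rewrite [X in index_iota 0 X]mE sum_subn_range; last by lia.
  by rewrite mulnS exprD -muln2 mulnA mulnAC muln2 -mE exprM dm expr1n mulr1.
rewrite exprMn -exprM; have -> : (m./2 * 2 = m)%N by lia.
by ring.
Qed.

Lemma S_det_mod (R : comNzRingType) (m n : nat) (alpha : 'I_m -> int) (d : int) :
  (S_det n alpha d)%:~R =
  \det (\matrix_(i < m, j < m) ((alpha i)%:~R + d%:~R * (alpha j)%:~R) ^+ n) :> R.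
Proof.
rewrite /S_det -det_map_mx; congr (\det _); apply/matrixP => i j.
by rewrite !mxE rmorphXn rmorphD rmorphM.
Qed.

(** With [g] a generator of the units, [chi g] has order [k]; so [chi (g ^ j) = 1] forces [k] to
    divide [j], and [p - 1 = k * m] divides [j * m]. *)
Lemma mulchar_val_eq1 (p k m : nat) (chi : 'CF([set: {unit 'F_p}])) (d : int) :
    prime p -> (k * m = p.-1)%N -> mulchar_of_order k chi ->
  mulchar_val chi d = 1 -> (d%:~R : 'F_p) ^+ m = 1.
Proof.
move=> p_prime km [chi_lin chi_order]; rewrite /mulchar_val.
case: insubP => [u _ <-|_ /esym/eqP]; last by rewrite oner_eq0.
have /cyclicP[g gP] := field_unit_group_cyclic [set: {unit 'F_p}]%G.
have in_g x : x \in <[g]>%g by rewrite -gP inE.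
have /cycleP[j ->] := in_g u; rewrite lin_charX ?inE // => chi_gj.
have /dvdnP[l ->] : (k %| j)%N.
  rewrite -chi_order; apply/dvdn_cforderP => x _; have /cycleP[b ->] := in_g x.
  by rewrite lin_charX ?inE // exprAC chi_gj expr1n.
rewrite -FinRing.val_unitX -expgM -mulnA km mulnC expgM.
have -> : p.-1 = #[g]%g.
  by rewrite -[#[g]%g]/#|<[g]>%g| -gP card_finField_unit card_Fp.
by rewrite expg_order expg1n.
Qed.

Lemma sqrtN1_Fp (p : nat) : prime p -> (4 %| p.-1)%N -> exists x : 'F_p, x ^+ 2 = -1.
Proof.
move=> p_prime /dvdnP[j pj].
have p_gt1 := prime_gt1 p_prime.
have /cyclicP[g gP] := field_unit_group_cyclic [set: {unit 'F_p}]%G.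
have g_order : #[g]%g = (j * 4)%N.
  by rewrite -[#[g]%g]/#|<[g]>%g| -gP card_finField_unit card_Fp // pj.
(* A generator to the power [(p - 1) / 4]: its square is a square root of 1 other than 1. *)
exists (val (g ^+ j)%g); rewrite -FinRing.val_unitX -expgM.
have /eqP : val (g ^+ (j * 2))%g ^+ 2 - 1 = 0 :> 'F_p.
  by rewrite -FinRing.val_unitX -expgM -mulnA -g_order expg_order subrr.
rewrite subr_eq0 sqrf_eq1 => /orP[/eqP g1|/eqP//].
have /eqP : (g ^+ (j * 2))%g = 1%g by apply: val_inj.
by rewrite -order_dvdn g_order => /dvdn_leq; lia.
Qed.

Lemma legendre_square (a : int) (p : nat) (x : 'F_p) :
  a%:~R = x ^+ 2 -> legendre a p <> -1.
Proof.
rewrite /legendre => ->; case: ifP => // _.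
by have -> : [exists y, y ^+ 2 == x ^+ 2] by apply/existsP; exists x.
Qed.

Lemma Fp_fermat (p : nat) (x : 'F_p) : prime p -> x != 0 -> x ^+ p.-1 = 1.
Proof.
move=> p_prime x_neq0; apply: (mulfI x_neq0).
by rewrite mulr1 -exprS prednK ?prime_gt0 // -[X in x ^+ X](card_Fp p_prime) expf_card.
Qed.

Local Close Scope ring_scope.

Theorem theorem1p3 (p k n : nat) (d : int)
  (alpha : 'I_((p - 1) %/ k) -> int) (chi : 'CF([set: {unit 'F_p}]))
  (p_prime : prime p) (p_odd : odd p)
  (k_bounds : 2 <= k <= (p - 1) %/ 2)
  (p_gt : 2 * k + 1 < p)
  (p_mod : p = 1 %[mod 2 * k])
  (alphaP : kth_power_residues p k alpha)
  (n_range : (p - 1) %/ k + 1 <= n <= 2 * (p - 1) %/ k - 1)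
  (n_odd : odd n)
  (chiP : mulchar_of_order k chi)
  (chi_d : mulchar_val chi d = 1%R) :
  (~~ odd k -> legendre (S_det n alpha d) p <> (-1)%R) /\
  (odd k ->
     (p = 1 %[mod 4 * k] -> legendre (S_det n alpha d) p <> (-1)%R) /\
     (p = 2 * k + 1 %[mod 4 * k] ->
        legendre (S_det n alpha d) p <> legendre d p)).
Proof.
have p_gt1 := prime_gt1 p_prime.
have k_gt0 : 0 < k by case/andP: k_bounds => /ltnW.
have k2_dvd : 2 * k %| p - 1 by rewrite -eqn_mod_dvd ?p_mod // ltnW.
set m := (p - 1) %/ k in alpha alphaP n_range *.
have km : k * m = p.-1.
  by rewrite mulnC divnK ?subn1 // -subn1; apply: dvdn_trans k2_dvd; rewrite dvdn_mull.
have n_bounds : m <= n < m.*2.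
  have m2 : 2 * (p - 1) %/ k = m.*2.
    by rewrite subn1 -km mulnCA mulKn ?mul2n //; lia.
  by move: n_range; rewrite m2; clear; case: (m) n; lia.
clearbody m; clear n_range k_bounds.
have m_even : ~~ odd m.
  by rewrite -dvdn2 -(dvdn_pmul2l k_gt0) km mulnC -subn1.
have m_gt0 : 0 < m by case: (m) km => //; lia.
have dm := mulchar_val_eq1 p_prime km chiP chi_d.
case: alphaP => a_inj a_range.
have am i : ((alpha i)%:~R ^+ m = 1 :> 'F_p)%R.
  have /a_range[a0 [y yk]] : exists j, (alpha j)%:~R%R = (alpha i)%:~R%R :> 'F_p.
    by exists i.
  rewrite -yk -exprM km Fp_fermat //.
  by apply: contraNneq a0 => y0; rewrite -yk y0 expr0n gtn_eqF //; lia.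
have [q] := det_power_sums_square m_gt0 m_even n_odd n_bounds a_inj am dm.
rewrite -S_det_mod; set D := (d%:~R)%R in dm *; set S := S_det n alpha d => S_def.
have sign_d : (D ^+ m./2 = 1 \/ D ^+ m./2 = -1)%R.
  have /eqP : (D ^+ m./2 ^+ 2 = 1)%R by rewrite -exprM muln2 even_halfK.
  by rewrite sqrf_eq1 => /orP[]/eqP; [left | right].
(* Once -1 is a square, [S] is a square for either sign of [D ^+ m./2]. *)
have p1mod4 : 4 %| p.-1 -> legendre S p <> (-1)%R.
  move=> /(sqrtN1_Fp p_prime)[i i2].
  case: sign_d S_def => -> S_def.
    by apply: (@legendre_square _ _ (i * q)%R); rewrite exprMn i2.
  by apply: (@legendre_square _ _ q); rewrite S_def opprK mul1r.
split=> [k_even|k_odd].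
  by apply: p1mod4; rewrite -km (@dvdn_mul 2 2) ?dvdn2.
split=> [p_mod4k|p_mod4k].
  apply: p1mod4; apply: (@dvdn_trans (4 * k)); first exact: dvdn_mulr.
  by rewrite -subn1 -eqn_mod_dvd ?p_mod4k // ltnW.
(* Here [m] is 2 modulo 4, so [(p - 1) / 2 = k * m./2] is odd and -1 is not a square. *)
have [h m_def] : exists h, m = h.*2.+1.*2.
  have : 4 * k %| k * (m - 2).
    rewrite mulnBr km; have -> : p.-1 - k * 2 = p - (2 * k + 1) by rewrite mulnC addnC subnDA subn1.
    by rewrite -eqn_mod_dvd ?p_mod4k // ltnW.
  rewrite mulnC dvdn_pmul2l //.
  by move=> /dvdnP[h mh]; exists h; clear -mh m_gt0 m_even; lia.
have half_m : m./2 = h.*2.+1 by rewrite m_def doubleK.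
have D_neq0 : (D != 0)%R := unity_root_neq0 m_gt0 dm.
rewrite {2}/legendre -/D (negPf D_neq0).
have N1_neq1 : (-1 != 1 :> 'F_p)%R.
  rewrite eq_sym -subr_eq0 opprK -(natrD _ 1 1) -(dvdn_pcharf (pchar_Fp p_prime)).
  by rewrite gtnNdvd ?odd_prime_gt2.
have N1_nonsq (x : 'F_p) : (x ^+ 2 <> -1)%R.
  move=> x2; have x0 : (x != 0)%R.
    by apply/eqP => x0; move/eqP: x2; rewrite x0 expr0n eq_sym oppr_eq0 oner_eq0.
  have /eqP := Fp_fermat p_prime x0; rewrite -km.
  have -> : k * m = 2 * (k * m./2) by rewrite mulnCA mul2n half_m -m_def.
  rewrite exprM x2 -signr_odd oddM k_odd half_m /= odd_double expr1.
  exact/negP.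
(* If [d] is a square, so is [D ^+ m./2], which is therefore 1; then [S = - q ^+ 2] is zero or a
   nonresidue. *)
case: existsP => [[y /eqP y2]|d_nonsq].
  have S_neg : (S%:~R = - q ^+ 2 :> 'F_p)%R.
    case: sign_d S_def => Dm -> ; first by rewrite Dm mulN1r.
    by case: (N1_nonsq (y ^+ m./2)%R); rewrite exprAC y2.
  rewrite /legendre; case: ifP => // S_neq0; case: existsP => // -[z /eqP z2] _.
  have q_neq0 : (q != 0)%R.
    by apply/eqP => q0; move: S_neq0; rewrite S_neg q0 expr0n oppr0 eqxx.
  by apply: (N1_nonsq (z / q)%R); rewrite expr_div_n z2 S_neg mulNr divff ?expf_neq0.
(* If [d] is not a square, [D ^+ m./2 = 1] is impossible: [m./2 = h.*2.+1] would give
   [D = (D ^+ h.+1) ^+ 2]. So the sign is -1 and [S = q ^+ 2]. *)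
case: sign_d S_def => Dm; rewrite Dm => S_def.
  case: d_nonsq; exists (D ^+ h.+1)%R; apply/eqP.
  by rewrite -exprM muln2 doubleS exprS -half_m Dm mulr1.
by apply: (@legendre_square _ _ q); rewrite S_def opprK mul1r.
Qed.
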